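(* Let $(G_n)_{n\ge1}$ be a sequence of weighted graphs with uniformly bounded edge weights such that $\frac{\alpha_{\max}(G_n)}{\alpha_{G_n}}\to 0$ as $n\to\infty$. Let $c_1,c_2$ be two lower threshold functions such that $c_1(q)q=h_1<h_2=c_2(q)q$ for all integers $q\ge1$, for some constants $0\le h_1,h_2\le 1$. If for every $q\ge1$ and every $J\in\mathrm{Sym}_q$ the sequence $(\hat{\mathcal{E}}^{c_2(q)}(G_n,J))_{n\ge1}$ converges, then for every $q\ge1$ and every $J\in\mathrm{Sym}_q$ the sequence $(\hat{\mathcal{E}}^{c_1(q)}(G_n,J))_{n\ge1}$ also converges.
   Context: A weighted graph $G$ is a finite graph with node weights $\alpha_i(G)>0$ for $i\in V(G)$ and symmetric real edge weights $\beta_{ij}(G)$ ($\beta_{ij}=0$ for non-edges). Write $\alpha_G=\sum_i\alpha_i(G)$ and $\alpha_{\max}(G)=\max_i\alpha_i(G)$. Uniformly bounded edge weights means $\sup_n\max_{i,j}|\beta_{ij}(G_n)|<\infty$. $\mathrm{Sym}_q$ is the set of symmetric $q\times q$ real matrices, $[q]=\{1,\dots,q\}$, and $\mathrm{Pd}_q$ is the set of probability distributions $\mathbf{a}=(a_1,\dots,a_q)$ on $[q]$. For $\phi:V(G)\to[q]$ and $J\in\mathrm{Sym}_q$ the energy is $$\mathcal{E}_\phi(G,J)=-\frac{1}{\alpha_G^2}\sum_{u,v\in V(G)}\alpha_u(G)\alpha_v(G)\beta_{uv}(G)J_{\phi(u)\phi(v)}$$ (for a simple graph, i.e. all node weights $1$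 and edge weights $1$ on edges and $0$ elsewhere, this is $-\frac{2}{|V(G)|^2}\sum_{uv\in E(G)}J_{\phi(u)\phi(v)}$). For $\mathbf{a}\in\mathrm{Pd}_q$ let $\Omega_{\mathbf{a}}(G)$ be the set of maps $\phi:V(G)\to[q]$ with $\bigl|\sum_{u\in\phi^{-1}(\{i\})}\alpha_u(G)-a_i\alpha_G\bigr|\le\alpha_{\max}(G)$ for all $i\in[q]$, and let $\hat{\mathcal{E}}_{\mathbf{a}}(G,J)=\min_{\phi\in\Omega_{\mathbf{a}}(G)}\mathcal{E}_\phi(G,J)$. For a real number $0\le c\le1/q$ let $A_c=\{\mathbf{a}\in\mathrm{Pd}_q: a_i\ge c,\ i=1,\dots,q\}$; the lower threshold ground state energy is $\hat{\mathcal{E}}^{c}(G,J)=\inf_{\mathbf{a}\in A_c}\hat{\mathcal{E}}_{\mathbf{a}}(G,J)$. A lower threshold function is a function $c$ from the positive integers to $[0,1]$ with $0\le c(q)\le 1/q$ for all $q$. *)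

(* Defs.v *)
From mathcomp Require Import all_boot all_order all_algebra.
From mathcomp Require Import all_classical all_reals all_analysis.

Set Implicit Arguments.
Unset Strict Implicit.
Unset Printing Implicit Defensive.

Import Order.TTheory GRing.Theory Num.Theory.
Import numFieldNormedType.Exports.

Local Open Scope classical_set_scope.
Local Open Scope ring_scope.

(* The vertex set is nonempty because every quantity below divides by the
   total node weight. Non-edges are the pairs with edge weight 0; loops are
   allowed. *)
Record weighted_graph (R : realType) := WeightedGraph {
  vertex : finType;
  node_weight : vertex -> R;
  edge_weight : vertex -> vertex -> R;
  vertex_nonempty : (0 < #|vertex|)%N;
  node_weight_gt0 : forall u, 0 < node_weight u;
  edge_weight_sym : forall u v, edge_weight u v = edge_weight v u
}.

Section GroundStateEnergy.
Variable R : realType.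
Implicit Types (G : weighted_graph R) (q : nat).

Definition alpha_tot G : R := \sum_(u : vertex G) node_weight u.

(* The default 0 is never the maximum, node weights being positive. *)
Definition alpha_max G : R := \big[Num.max/0]_(u : vertex G) node_weight u.

Definition unif_bounded_edge_weights (G : nat -> weighted_graph R) : Prop :=
  exists B : R, forall n (u v : vertex (G n)), `|edge_weight u v| <= B.

Definition sym_mx q : set 'M[R]_q := [set J | J^T = J].

Definition prob_dist q : set ('I_q -> R) :=
  [set a | (forall i, 0 <= a i) /\ \sum_(i < q) a i = 1].

Definition energy G q (phi : {ffun vertex G -> 'I_q}) (J : 'M[R]_q) : R :=
  - ((alpha_tot G ^+ 2)^-1 *
     \sum_(u : vertex G) \sum_(v : vertex G)
        node_weight u * node_weight v * edge_weight u v * J (phi u) (phi v)).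

Definition Omega G q (a : 'I_q -> R) : set {ffun vertex G -> 'I_q} :=
  [set phi | forall i : 'I_q,
     `|\sum_(u : vertex G | phi u == i) node_weight u - a i * alpha_tot G|
       <= alpha_max G].
Arguments Omega G {q} a _.

(* For a in prob_dist, Omega G a is finite and nonempty (list the vertices,
   cut [0, alpha_tot G] into consecutive intervals of lengths
   a i * alpha_tot G, and colour each vertex by the interval containing the
   total weight of its predecessors), so this infimum is a minimum. *)
Definition microcanonical_gse G q (a : 'I_q -> R) (J : 'M[R]_q) : R :=
  inf [set energy phi J | phi in Omega G a].

Definition dist_ge q (c : R) : set ('I_q -> R) :=
  [set a | prob_dist a /\ forall i, c <= a i].

Definition lower_threshold_gse (c : R) G q (J : 'M[R]_q) : R :=
  inf [set microcanonical_gse G a J | a in @dist_ge q c].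

(* Only the values at positive integers are relevant. *)
Definition lower_threshold_function (c : nat -> R) : Prop :=
  forall q, (0 < q)%N -> 0 <= c q <= q%:R^-1.

End GroundStateEnergy.

Arguments Omega {R} G {q} a _.

(* Main.v *)
Require Import Defs.
From mathcomp Require Import all_boot all_order all_algebra.
From mathcomp Require Import all_classical all_reals all_analysis.
From mathcomp Require Import ring lra.

Set Implicit Arguments.
Unset Strict Implicit.
Unset Printing Implicit Defensive.

Import Order.TTheory GRing.Theory Num.Theory.
Import numFieldNormedType.Exports.

Local Open Scope classical_set_scope.
Local Open Scope ring_scope.

(** Colour with r colours instead of q, where r is large, and merge them by a
    map p from [r] to [q].  For the matrix J (p k) (p l), the energy of an
    r-colouring is the energy under J of the merged q-colouring
    (energy_coarsen).  If every colour k has weight at least h2 / r, then the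
    merged colour i has weight at least m_i h2 / r, where m_i is the size of
    the fiber of p over i.  Call p good when m_i h2 / r >= h1 / q + d for all
    i, with d > 0 fixed.

    - For good p, the ground state energy of J with threshold h1 / q is at
      most that of the pulled back matrix with threshold h2 / r, as soon as
      the largest node weight is small enough for d to absorb the rounding
      errors (gse_le_pullback).
    - Conversely, a nearly optimal q-colouring for the threshold h1 / q
      has a nearly proportional distribution a with a_i >= h1 / q.  Since
      h1 < h2, numbers between the h1 / q and the a_i can be found that add up
      to h2; rounding them to multiples of h2 / r gives a good p and a
      distribution b close to a with b_i >= m_i h2 / r (exists_fibers).
      Recolour a few vertices to reach b, then split each class i evenly among
      the m_i colours above it (refine_coloring).  Few vertices change their
      merged colour, so the energy hardly changes (energy_lipschitz).

    Hence, for r large, the energies with threshold h1 / q are asymptotically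
    within any given error of a minimum of finitely many convergent sequences,
    one for each good p (gse_sandwich), and so they form a Cauchy sequence.

    Every recolouring rests on one rounding lemma: a colouring can be changed
    so that each class is within one node weight of a prescribed target, by
    moving a weight proportional to the initial discrepancy (rounding). *)

(** * Colourings with prescribed class weights *)

Section Rounding.
Variable R : realType.

Definition class_weight (T C : finType) (w : T -> R) (f : {ffun T -> C}) c : R :=
  \sum_(u | f u == c) w u.

Definition moved_weight (T C : finType) (w : T -> R) (f g : {ffun T -> C}) : R :=
  \sum_(u | f u != g u) w u.

Lemma class_weight_sum (T C : finType) (w : T -> R) (f : {ffun T -> C}) :
  \sum_c class_weight w f c = \sum_u w u.
Proof. by rewrite [RHS](partition_big f xpredT). Qed.

(** Pigeonhole: the deviations from the targets add up to 0, so the excess of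
    one class is compensated by the deficits of the others, one of which is at
    least the average. *)
Lemma opposite_large (C : finType) (e : C -> R) i :
  \sum_c e c = 0 -> 0 < e i ->
  exists2 j, j != i & e i <= #|C|%:R * - e j.
Proof.
move=> e0 ei0; apply: contrapT => noj.
have Cgt0 : (0 < #|C|)%N by apply/card_gt0P; exists i.
have lt j : j != i -> #|C|%:R * - e j <= e i.
  move=> ji; rewrite leNgt; apply/negP => lej; apply: noj.
  by exists j => //; exact: ltW.
have e_i : e i = \sum_(j | j != i) - e j.
  by move: e0; rewrite (bigD1 i) //= sumrN => /eqP; rewrite addr_eq0 => /eqP.
have lt' j : j != i -> #|C|%:R * - e j < e i.
  move=> ji; rewrite lt_neqAle lt // andbT; apply/eqP => ej.
  by apply: noj; exists j; rewrite ?ej.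
have : #|C|%:R * e i <= \sum_(j | j != i) e i.
  rewrite {1}e_i mulr_sumr; exact: ler_sum.
rewrite sumr_const -[e i *+ _]mulr_natl ler_pM2r // ler_nat.
rewrite leqNgt => /negP; apply.
rewrite -(cardC (pred1 i)) card1 add1n ltnS.
by apply: subset_leq_card; apply/fintype.subsetP => j; rewrite !inE.
Qed.

Lemma class_weightE (T C : finType) (w : T -> R) (f : {ffun T -> C}) c :
  class_weight w f c = \sum_u w u * (f u == c)%:R.
Proof.
rewrite /class_weight big_mkcond; apply: eq_bigr => u _.
by case: ifP => _; rewrite ?mulr1 ?mulr0.
Qed.

Definition recolor (T C : finType) (f : {ffun T -> C}) u j : {ffun T -> C} :=
  [ffun x => if x == u then j else f x].

Lemma class_weight_recolor (T C : finType) (w : T -> R) (f : {ffun T -> C}) u j c :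
  class_weight w (recolor f u j) c =
  class_weight w f c + w u * (j == c)%:R - w u * (f u == c)%:R.
Proof.
rewrite !class_weightE (bigD1 u) //= [in RHS](bigD1 u) //= ffunE eqxx.
rewrite (eq_bigr (fun x => w x * (f x == c)%:R)); first by lra.
by move=> x /negPf xu; rewrite ffunE xu.
Qed.

Lemma moved_weight_recolor (T C : finType) (w : T -> R) (f g : {ffun T -> C}) u j :
  0 <= w u -> moved_weight w (recolor f u j) g <= moved_weight w f g + w u.
Proof.
move=> wu; rewrite /moved_weight big_mkcond [X in _ <= X + _]big_mkcond (bigD1 u) //=.
rewrite [X in _ <= X + _](bigD1 u) //= addrAC ffunE eqxx lerD //.
  by case: (j != g u); case: (f u != g u); lra.
by apply: ler_sum => x /negPf xu; rewrite ffunE xu.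
Qed.

(** Effect on a total discrepancy of moving weight v from a class with excess x
    to a class with deficit - y: one of the two terms decreases by v, and the
    other changes by at most v - 2 min(v, deficit or excess), where that
    minimum is at least v / N. *)
Lemma unit_transfer (N S M x y v : R) : 1 <= N -> 0 <= v <= M ->
  0 <= x -> 0 <= - y -> M <= N * x -> M <= N * - y -> M <= x \/ M <= - y ->
  N * (`|x - v| + (`|y + v| + S)) + 2 * v <= N * (x + (- y + S)).
Proof.
move=> N1 /andP[v0 vM] x0 y0 Nx Ny big.
have [xv|xv] := leP v x; have [yv|yv] := leP v (- y).
- rewrite (ger0_norm (_ : 0 <= x - v)) ?(ler0_norm (_ : y + v <= 0)); [nra|lra|lra].
- rewrite (ger0_norm (_ : 0 <= x - v)) ?(ger0_norm (_ : 0 <= y + v)); [nra|lra|lra].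
- rewrite (ler0_norm (_ : x - v <= 0)) ?(ler0_norm (_ : y + v <= 0)); [nra|lra|lra].
- by exfalso; lra.
Qed.

Lemma recolor_improves (T C : finType) (w : T -> R) (M : R) (a : C -> R)
    (f : {ffun T -> C}) u j :
  let e c := class_weight w f c - a c in
  0 <= w u <= M -> j != f u ->
  0 <= e (f u) -> 0 <= - e j ->
  M <= #|C|%:R * e (f u) -> M <= #|C|%:R * - e j ->
  M <= e (f u) \/ M <= - e j ->
  #|C|%:R * \sum_c `|class_weight w (recolor f u j) c - a c| + 2 * w u
    <= #|C|%:R * \sum_c `|e c|.
Proof.
move=> e wM ji ei ej ei' ej' big.
rewrite (bigD1 (f u)) // [in X in _ <= X](bigD1 (f u)) //=.
rewrite (bigD1 j) // [in X in _ <= X](bigD1 j) //=.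
rewrite (eq_bigr (fun c => `|e c|)); last first.
  move=> c /andP[/negPf cu /negPf cj].
  rewrite class_weight_recolor [j == c]eq_sym cj [f u == c]eq_sym cu.
  by rewrite !mulr0 addr0 subr0.
rewrite !class_weight_recolor eqxx (negPf ji) eqxx [f u == j]eq_sym (negPf ji).
set S := \sum_(_ | _) _.
have -> : class_weight w f (f u) + w u * false%:R - w u * true%:R - a (f u) =
  e (f u) - w u by rewrite /e /=; lra.
have -> : class_weight w f j + w u * true%:R - w u * false%:R - a j =
  e j + w u by rewrite /e /=; lra.
rewrite (ger0_norm ei) (ler0_norm (_ : e j <= 0)); last lra.
have N1 : 1 <= #|C|%:R :> R.
  by rewrite ler1n; apply/card_gt0P; exists j.
set N : R := #|C|%:R in N1 ei' ej' *.
exact: (unit_transfer S N1 wM).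
Qed.

(** Minimise #|C| times the total discrepancy plus the weight moved from f0.
    While some class misses its target by more than M, moving one vertex
    between that class and an opposite one given by opposite_large lowers the
    discrepancy term by at least twice the weight of the vertex, while the
    moved weight grows by at most that weight: a minimiser meets all targets.
    Comparing it with f0 bounds the moved weight. *)
Lemma rounding (T C : finType) (w : T -> R) (M : R) (a : C -> R)
    (f0 : {ffun T -> C}) :
  0 <= M -> (forall u, 0 <= w u <= M) -> (forall c, 0 <= a c) ->
  \sum_c a c = \sum_u w u ->
  exists f : {ffun T -> C},
    (forall c, `|class_weight w f c - a c| <= M) /\
    moved_weight w f f0 <= #|C|%:R * \sum_c `|class_weight w f0 c - a c|.
Proof.
move=> M0 wM a0 aw.
pose Phi f := #|C|%:R * (\sum_c `|class_weight w f c - a c|) + moved_weight w f f0.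
have [f _ fmin] := @arg_minP _ R _ f0 xpredT Phi isT.
exists f; split; last first.
  have : Phi f <= Phi f0 by exact: fmin.
  rewrite /Phi [X in _ <= _ + X]big1 ?addr0; last by move=> u; rewrite eqxx.
  have : 0 <= #|C|%:R * \sum_c `|class_weight w f c - a c|.
    by apply: mulr_ge0 => //; apply: sumr_ge0.
  lra.
pose e c := class_weight w f c - a c.
have e0 : \sum_c e c = 0 by rewrite sumrB class_weight_sum aw subrr.
have main i j : j != i -> 0 < e i -> 0 < - e j ->
    M <= #|C|%:R * e i -> M <= #|C|%:R * - e j ->
    M <= e i \/ M <= - e j -> False.
  move=> ji ei ej Mi Mj big.
  (* A class in excess of its nonnegative target has positive weight. *)
  have [u /andP[/eqP fu wu]] : exists u, (f u == i) && (0 < w u).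
    apply: contrapT => nou.
    suff : class_weight w f i <= 0 by move: ei (a0 i); rewrite /e; lra.
    apply: sumr_le0 => u fu; rewrite leNgt; apply/negP => wu.
    by apply: nou; exists u; rewrite fu.
  rewrite -fu in ji ei Mi big.
  have := recolor_improves (wM u) ji (ltW ei) (ltW ej) Mi Mj big.
  have := fmin (recolor f u j) isT; rewrite /Phi.
  have := moved_weight_recolor f f0 j (ltW wu).
  lra.
move=> c; rewrite leNgt; apply/negP => Mc; change (is_true (M < `|e c|)) in Mc.
have C1 : 1 <= #|C|%:R :> R.
  by rewrite ler1n; apply/card_gt0P; exists c.
case: (lerP 0 (e c)) => ec.
  rewrite ger0_norm // in Mc.
  have [|j jc ej] := opposite_large e0 (i := c); first lra.
  apply: (main c j jc) => //; try nra; by left; lra.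
rewrite ltr0_norm // in Mc.
have [||j jc ej] := @opposite_large _ (fun c => - e c) c; rewrite ?sumrN ?e0 ?oppr0//.
  lra.
rewrite opprK in ej.
apply: (main j c); rewrite 1?eq_sym //; try nra; by right; lra.
Qed.
End Rounding.

(** * Merging and splitting colours *)

Section Refinement.
Variable R : realType.

Definition coarsen (T C I : finType) (p : {ffun C -> I}) (f : {ffun T -> C}) :
  {ffun T -> I} := [ffun u => p (f u)].

(** The number of colours merged into i, as a class weight, so that rounding
    can prescribe it. *)
Definition fiber_size (C I : finType) (p : {ffun C -> I}) (i : I) : R :=
  class_weight (fun=> 1) p i.

Lemma sum_fiber (C I : finType) (p : {ffun C -> I}) i (x : R) :
  \sum_(k | p k == i) x = fiber_size p i * x.
Proof.
by rewrite /fiber_size /class_weight mulr_suml; apply: eq_bigr => k _; rewrite mul1r.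
Qed.

Lemma sum_constant_on_fibers (C I : finType) (p : {ffun C -> I}) (x : I -> R) :
  (forall i, 0 < fiber_size p i) ->
  \sum_k x (p k) / fiber_size p (p k) = \sum_i x i.
Proof.
move=> p0; rewrite (partition_big p xpredT) //=; apply: eq_bigr => i _.
rewrite (eq_bigr (fun=> x i / fiber_size p i)); last by move=> k /eqP ->.
by rewrite sum_fiber mulrC divfK ?gt_eqF.
Qed.

Lemma fiber_size_ge1 (C I : finType) (p : {ffun C -> I}) k :
  1 <= fiber_size p (p k).
Proof.
rewrite /fiber_size /class_weight (bigD1 k) //= lerDl.
by apply: sumr_ge0.
Qed.

Lemma class_weight_coarsen (T C I : finType) (w : T -> R) (p : {ffun C -> I})
    (f : {ffun T -> C}) i :
  class_weight w (coarsen p f) i = \sum_(k | p k == i) class_weight w f k.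
Proof.
rewrite /class_weight (partition_big f (fun k => p k == i)) /=; last first.
  by move=> u; rewrite ffunE.
apply: eq_bigr => k /eqP pk; apply: eq_bigl => u; rewrite ffunE.
by case: (f u =P k) => [->|]; rewrite ?pk ?eqxx ?andbF.
Qed.

Lemma moved_weight_coarsen (T C I : finType) (w : T -> R) (p : {ffun C -> I})
    (f g : {ffun T -> C}) : (forall u, 0 <= w u) ->
  moved_weight w (coarsen p f) (coarsen p g) <= moved_weight w f g.
Proof.
move=> w0; rewrite /moved_weight big_mkcond [leRHS]big_mkcond /=.
apply: ler_sum => u _; rewrite !ffunE.
by case: (f u =P g u) => [->|_]; rewrite ?eqxx //=; case: ifP.
Qed.

Lemma moved_weight_trans (T C : finType) (w : T -> R) (f g h : {ffun T -> C}) :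
  (forall u, 0 <= w u) ->
  moved_weight w f h <= moved_weight w f g + moved_weight w g h.
Proof.
move=> w0; rewrite /moved_weight big_mkcond [X in _ <= X + _]big_mkcond.
rewrite [X in _ <= _ + X]big_mkcond -big_split /=.
apply: ler_sum => u _; have := w0 u.
case: (f u =P g u) => [->|_]; first by case: ifP => _ /=; lra.
by case: ifP => _; case: ifP => _ /=; lra.
Qed.

(** Each class of f is rounded separately, all other vertices getting weight
    0. *)
Lemma rounding_matrix (T I C : finType) (w : T -> R) (M : R)
    (f : {ffun T -> I}) (t : I -> C -> R) (k0 : C) :
  0 <= M -> (forall u, 0 <= w u <= M) -> (forall i k, 0 <= t i k) ->
  (forall i, \sum_k t i k = class_weight w f i) ->
  exists g : {ffun T -> C}, forall i k,
    `|\sum_(u | (f u == i) && (g u == k)) w u - t i k| <= M.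
Proof.
move=> M0 wM t0 tw.
have /fin_all_exists[h hP] i : exists g : {ffun T -> C}, forall k,
    `|\sum_(u | (f u == i) && (g u == k)) w u - t i k| <= M.
  have [|||g [gM _]] := @rounding _ _ _ (fun u => if f u == i then w u else 0) M
    (t i) [ffun=> k0] M0.
  - by move=> u; case: ifP => _; rewrite ?lexx //.
  - by [].
  - by rewrite tw /class_weight -big_mkcond.
  exists g => k; move: (gM k); rewrite /class_weight -big_mkcondr /=.
  by under eq_bigl do rewrite andbC.
exists [ffun u => h (f u) u] => i k; apply: le_trans (hP i k).
rewrite (eq_bigl (fun u => (f u == i) && (h i u == k))) // => u.
by rewrite ffunE; case: eqP => [->|].
Qed.

(** Class i is split evenly among the colours of the fiber over i.  Some
    vertices may receive a colour outside that fiber, but since the target of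
    such a colour within class i is 0, their weight is at most M for each pair
    of colours. *)
Lemma even_refinement (T I C : finType) (w : T -> R) (M : R)
    (f : {ffun T -> I}) (p : {ffun C -> I}) (k0 : C) :
  0 <= M -> (forall u, 0 <= w u <= M) -> (forall i, 0 < fiber_size p i) ->
  exists g : {ffun T -> C},
    (forall k, `|class_weight w g k - class_weight w f (p k) / fiber_size p (p k)|
       <= #|I|%:R * M) /\
    moved_weight w (coarsen p g) f <= #|I|%:R * #|C|%:R * M.
Proof.
move=> M0 wM p0.
pose t i k := if p k == i then class_weight w f i / fiber_size p i else 0.
have [|i|g gM] := @rounding_matrix T I C w M f t k0 M0 wM.
- move=> i k; rewrite /t; case: ifP => // _; apply: divr_ge0; last exact: ltW.
  by apply: sumr_ge0 => u _; have /andP[] := wM u.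
- by rewrite /t -big_mkcond sum_fiber mulrC divfK ?gt_eqF.
exists g; split=> [k|].
  have -> : class_weight w f (p k) / fiber_size p (p k) = \sum_i t i k.
    by rewrite /t -big_mkcond /= (big_pred1 (p k)) // => i; rewrite eq_sym.
  rewrite [class_weight w g k](partition_big f xpredT) //= -sumrB.
  apply: (le_trans (ler_norm_sum _ _ _)).
  rewrite mulr_natl -sumr_const; apply: ler_sum => i _.
  by under eq_bigl do rewrite andbC.
rewrite /moved_weight (partition_big f xpredT) //= -mulrA mulr_natl -sumr_const.
apply: ler_sum => i _; rewrite (partition_big g xpredT) //= mulr_natl -sumr_const.
apply: ler_sum => k _; have [pk|pk] := eqVneq (p k) i.
  rewrite big_pred0 // => u; rewrite ffunE.
  by case: (f u =P i) => [->|]; case: (g u =P k) => [->|]; rewrite ?pk ?eqxx ?andbF.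
have := gM i k; rewrite /t (negPf pk) subr0; apply: le_trans.
rewrite ger0_norm; last by apply: sumr_ge0 => u _; have /andP[] := wM u.
rewrite (eq_bigl (fun u => (f u == i) && (g u == k))) // => u; rewrite ffunE.
case: (f u =P i) => [->|]; case: (g u =P k) => [->|]; rewrite ?pk ?andbF //.
Qed.
End Refinement.

(** * Energies and ground state energies *)

Section GroundStates.
Variable R : realType.
Implicit Type G : weighted_graph R.

Lemma alpha_tot_gt0 G : 0 < alpha_tot G.
Proof.
have /card_gt0P[u _] := vertex_nonempty G.
rewrite /alpha_tot (bigD1 u) //= ltr_pwDl ?node_weight_gt0 //.
by apply: sumr_ge0 => v _; exact/ltW/node_weight_gt0.
Qed.

Lemma node_weight_le_max G (u : vertex G) : 0 <= node_weight u <= alpha_max G.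
Proof. by rewrite ltW ?node_weight_gt0 //=; exact: le_bigmax. Qed.

Lemma alpha_max_ge0 G : 0 <= alpha_max G.
Proof. exact: bigmax_ge_id. Qed.

Definition pullback_mx q r (p : {ffun 'I_r -> 'I_q}) (J : 'M[R]_q) : 'M[R]_r :=
  \matrix_(k, l) J (p k) (p l).

Lemma pullback_mx_sym q r (p : {ffun 'I_r -> 'I_q}) (J : 'M[R]_q) :
  sym_mx J -> sym_mx (pullback_mx p J).
Proof.
move=> symJ; apply/matrixP => k l; rewrite !mxE.
by rewrite -[in LHS](symJ : J^T = J) mxE.
Qed.

Lemma energy_coarsen G q r (p : {ffun 'I_r -> 'I_q}) (J : 'M[R]_q)
    (f : {ffun vertex G -> 'I_r}) :
  energy f (pullback_mx p J) = energy (coarsen p f) J.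
Proof.
rewrite /energy; congr (- (_ * _)); apply: eq_bigr => u _; apply: eq_bigr => v _.
by rewrite mxE !ffunE.
Qed.

(** A term of the energy changes only if one of its two endpoints is recoloured;
    the terms with a given recoloured endpoint u have total weight
    proportional to the weight of u times the total weight. *)
Lemma energy_lipschitz G q (J : 'M[R]_q) (B K : R)
    (f g : {ffun vertex G -> 'I_q}) :
  (forall u v : vertex G, `|edge_weight u v| <= B) ->
  (forall i j, `|J i j| <= K) ->
  `|energy f J - energy g J| <=
    4 * B * K * (moved_weight (@node_weight R G) f g / alpha_tot G).
Proof.
move=> leB leK; set w := @node_weight R G; set A := alpha_tot G.
have A0 : 0 < A := alpha_tot_gt0 G.
have w0 u : 0 <= w u by exact/ltW/node_weight_gt0.
pose d u : R := (f u != g u)%:R.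
have moved : moved_weight w f g = \sum_u w u * d u.
  rewrite /moved_weight big_mkcond; apply: eq_bigr => u _; rewrite /d.
  by case: ifP; rewrite ?mulr1 ?mulr0.
have dJ u v : `|J (g u) (g v) - J (f u) (f v)| <= 2 * K * (d u + d v).
  have := leK (g u) (g v); have := leK (f u) (f v) => Kf Kg.
  have K0 : 0 <= K := le_trans (normr_ge0 _) Kf.
  rewrite /d; case: (f u =P g u) => [->|_]; case: (f v =P g v) => [->|_] /=.
  - by rewrite subrr normr0 addr0 mulr0.
  - apply: (le_trans (ler_normB _ _)); have := leK (g u) (f v); lra.
  - apply: (le_trans (ler_normB _ _)); have := leK (f u) (g v); lra.
  - apply: (le_trans (ler_normB _ _)); lra.
have -> : energy f J - energy g J = (A ^+ 2)^-1 *
    \sum_u \sum_v w u * w v * edge_weight u v * (J (g u) (g v) - J (f u) (f v)).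
  rewrite /energy opprK addrC -mulrBr -sumrB; congr (_ * _).
  apply: eq_bigr => u _; rewrite -sumrB; apply: eq_bigr => v _.
  by rewrite mulrBr.
rewrite normrM (ger0_norm (_ : 0 <= (A ^+ 2)^-1)) ?invr_ge0 ?sqr_ge0 //.
rewrite [leLHS]mulrC ler_pdivrMr ?exprn_gt0 //.
have -> : 4 * B * K * (moved_weight w f g / A) * A ^+ 2 =
    \sum_u \sum_v w u * w v * B * (2 * K * (d u + d v)).
  transitivity (2 * B * K * (moved_weight w f g * A + A * moved_weight w f g)).
    by field; rewrite gt_eqF.
  rewrite moved /A /alpha_tot !big_distrlr /= -big_split /= mulr_sumr.
  apply: eq_bigr => u _; rewrite -big_split /= mulr_sumr.
  by apply: eq_bigr => v _; rewrite -/w; ring.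
apply: (le_trans (ler_norm_sum _ _ _)); apply: ler_sum => u _.
apply: (le_trans (ler_norm_sum _ _ _)); apply: ler_sum => v _.
rewrite normrM ler_pM // normrM (ger0_norm (mulr_ge0 (w0 u) (w0 v))).
by rewrite ler_wpM2l // mulr_ge0.
Qed.

Lemma nearby_Omega G q (a : 'I_q -> R) (f0 : {ffun vertex G -> 'I_q}) :
  prob_dist a ->
  exists2 f, Omega G a f & moved_weight (@node_weight R G) f f0 <=
    q%:R * \sum_i `|class_weight (@node_weight R G) f0 i - a i * alpha_tot G|.
Proof.
move=> [a0 a1].
have [||f [fa ff0]] := rounding (a := fun i => a i * alpha_tot G) f0
  (alpha_max_ge0 G) (@node_weight_le_max G).
- by move=> i; rewrite mulr_ge0 // ltW // alpha_tot_gt0.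
- by rewrite -mulr_suml a1 mul1r.
by exists f => //; rewrite card_ord in ff0.
Qed.

Lemma Omega_nonempty G q (a : 'I_q -> R) : prob_dist a -> Omega G a !=set0.
Proof.
move=> pa; have i0 : 'I_q.
  case: q a pa => [a [_]|q *]; last exact: ord0.
  by rewrite big_ord0 => /eqP; rewrite eq_sym oner_eq0.
by have [f fa _] := @nearby_Omega G q a [ffun=> i0] pa; exists f.
Qed.

Lemma uniform_dist_ge q (c : R) : (0 < q)%N -> c <= q%:R^-1 ->
  dist_ge c (fun _ : 'I_q => q%:R^-1).
Proof.
move=> q0 cq; split=> //; split=> [i|]; first by rewrite invr_ge0.
by rewrite sumr_const card_ord -[_ *+ _]mulr_natl divff // pnatr_eq0 -lt0n.
Qed.

Lemma energy_lbound G q (J : 'M[R]_q) :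
  exists m, forall f : {ffun vertex G -> 'I_q}, m <= energy f J.
Proof.
exists (- \sum_(g : {ffun vertex G -> 'I_q}) `|energy g J|) => f.
rewrite (bigD1 f) //= opprD; set S := \sum_(_ | _) _.
have : 0 <= S by exact: sumr_ge0.
have := ler_norm (- energy f J); rewrite normrN; lra.
Qed.

Lemma energies_has_inf G q (a : 'I_q -> R) (J : 'M[R]_q) :
  prob_dist a -> has_inf [set energy f J | f in Omega G a].
Proof.
move=> pa; split; first by have [f fa] := Omega_nonempty G pa; exists (energy f J), f.
by have [m mJ] := energy_lbound G J; exists m => _ [f _ <-].
Qed.

Lemma microcanonical_has_lbound (c : R) G q (J : 'M[R]_q) :
  has_lbound [set microcanonical_gse G a J | a in @dist_ge R q c].
Proof.
have [m mJ] := energy_lbound G J; exists m => _ [a [pa _] <-].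
by apply: lb_le_inf; [exact: (energies_has_inf G J pa).1 | move=> _ [f _ <-]].
Qed.

(** lower_threshold_gse_le and lower_threshold_gse_adherent describe the nested
    infimum as a single infimum over colourings.  The nonemptiness of Omega is
    essential: the infimum of an empty set would be the value 0. *)
Lemma lower_threshold_gse_le (c : R) G q (a : 'I_q -> R) (J : 'M[R]_q) f :
  dist_ge c a -> Omega G a f -> lower_threshold_gse c G J <= energy f J.
Proof.
move=> ca fa; apply: (@le_trans _ _ (microcanonical_gse G a J)).
  by apply: ge_inf; [exact: microcanonical_has_lbound | exists a].
by apply: ge_inf; [exact: (energies_has_inf G J ca.1).2 | exists f].
Qed.

Lemma lower_threshold_gse_adherent (c e : R) G q (J : 'M[R]_q) :
  (0 < q)%N -> c <= q%:R^-1 -> 0 < e ->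
  exists a f, [/\ @dist_ge R q c a, Omega G a f &
    energy f J < lower_threshold_gse c G J + e].
Proof.
move=> q0 cq e0; have e2 : 0 < e / 2 by rewrite divr_gt0.
have [|_ [a ca <-] lt_a] := @inf_adherent _
    [set microcanonical_gse G a J | a in @dist_ge R q c] _ e2.
  split; last exact: microcanonical_has_lbound.
  by eexists; eexists; [exact: uniform_dist_ge|].
have [_ [f fa <-] lt_f] := inf_adherent e2 (energies_has_inf G J ca.1).
exists a, f; split=> //.
rewrite /lower_threshold_gse; rewrite /microcanonical_gse in lt_a *.
lra.
Qed.
End GroundStates.

(** * Comparing the two thresholds *)

Section Comparison.
Variable R : realType.
Implicit Type G : weighted_graph R.

Lemma fiber_size_le (C I : finType) (p : {ffun C -> I}) i :
  fiber_size R p i <= #|C|%:R.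
Proof.
rewrite /fiber_size /class_weight big_mkcond -sum1_card natr_sum.
by apply: ler_sum => k _; case: ifP.
Qed.

(** The merged colouring is a witness for its own distribution, so no rounding
    is needed provided that this distribution respects the threshold c.  It
    does, because merged classes lose at most alpha_max per merged colour,
    which d absorbs. *)
Lemma gse_le_pullback G q r (p : {ffun 'I_r -> 'I_q}) (c c' d : R) (J : 'M[R]_q) :
  (0 < r)%N -> 0 <= c -> c' <= r%:R^-1 ->
  (forall i, c + d <= fiber_size R p i * c') ->
  r%:R * alpha_max G <= d * alpha_tot G ->
  lower_threshold_gse c G J <= lower_threshold_gse c' G (pullback_mx p J).
Proof.
move=> r0 c0 c'r pc rd; apply/ler_addgt0Pr => e e0.
have [a [f [[_ c'a] af /ltW]]] := lower_threshold_gse_adherent G (pullback_mx p J) r0 c'r e0.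
apply: le_trans; rewrite energy_coarsen.
have A0 := alpha_tot_gt0 G.
pose b i := class_weight (@node_weight R G) (coarsen p f) i / alpha_tot G.
have cb i : c <= b i.
  rewrite ler_pdivlMr // class_weight_coarsen.
  have : \sum_(k | p k == i) (c' * alpha_tot G - alpha_max G) <=
      \sum_(k | p k == i) class_weight (@node_weight R G) f k.
    apply: ler_sum => k _; have := af k; rewrite ler_norml => /andP[+ _].
    have := ler_wpM2r (ltW A0) (c'a k); rewrite /class_weight; lra.
  rewrite sum_fiber; apply: le_trans.
  have := fiber_size_le p i; rewrite card_ord => pr.
  have := ler_wpM2r (alpha_max_ge0 G) pr.
  have := ler_wpM2r (ltW A0) (pc i); lra.
apply: (@lower_threshold_gse_le _ _ _ _ b).
  split=> //; split=> [i|]; first exact: le_trans (cb i).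
  by rewrite -mulr_suml class_weight_sum divff ?gt_eqF.
move=> i; rewrite /b divfK ?gt_eqF // subrr normr0; exact: alpha_max_ge0.
Qed.

(** First recolour to reach b, then split evenly, then round to the exact
    target.  The order matters: the cost of rounding is the discrepancy times
    the number of colours, so the discrepancy between a and b must be paid
    with q colours; the final rounding with r colours only repairs errors of
    order alpha_max. *)
Lemma refine_coloring G q r (p : {ffun 'I_r -> 'I_q}) (a b : 'I_q -> R) f :
  (0 < r)%N -> prob_dist b -> (forall i, 0 < fiber_size R p i) -> Omega G a f ->
  exists2 f', Omega G (fun k => b (p k) / fiber_size R p (p k)) f' &
    moved_weight (@node_weight R G) (coarsen p f') f <=
      q%:R * (\sum_i `|a i - b i|) * alpha_tot G +
      (q%:R ^+ 2 + q%:R * r%:R + r%:R ^+ 2 * (q%:R + 1)) * alpha_max G.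
Proof.
move=> r0 pb p0 af; set w := @node_weight R G.
have A0 := alpha_tot_gt0 G; have M0 := alpha_max_ge0 G.
have w0 u : 0 <= w u by exact/ltW/node_weight_gt0.
have [g bg gf] := nearby_Omega f pb.
have [h [hg cg]] := even_refinement g (Ordinal r0) M0 (@node_weight_le_max _ G) p0.
have pb' : prob_dist (fun k => b (p k) / fiber_size R p (p k)).
  split=> [k|]; first by apply: divr_ge0; [exact: pb.1|exact: ltW].
  by rewrite sum_constant_on_fibers //; exact: pb.2.
have [f' bf' fh] := nearby_Omega h pb'.
exists f' => //.
have {}gf : moved_weight w g f <= q%:R * (q%:R * alpha_max G +
    (\sum_i `|a i - b i|) * alpha_tot G).
  apply: (le_trans gf); rewrite ler_wpM2l //.
  have -> : q%:R * alpha_max G = \sum_(i < q) alpha_max G.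
    by rewrite sumr_const card_ord mulr_natl.
  rewrite mulr_suml -big_split /=; apply: ler_sum => i _.
  rewrite (_ : `|a i - b i| * _ = `|(a i - b i) * alpha_tot G|);
    last by rewrite normrM (gtr0_norm A0).
  apply: le_trans (lerD (af i) (lexx _)); apply: le_trans (ler_normD _ _).
  by rewrite mulrBl addrA subrK.
have {}fh : moved_weight w f' h <= r%:R * (r%:R * ((q%:R + 1) * alpha_max G)).
  apply: (le_trans fh); rewrite ler_wpM2l //.
  rewrite mulr_natl -[X in _ *+ X]card_ord -sumr_const; apply: ler_sum => k _.
  have := hg k; rewrite card_ord => hgk.
  rewrite mulrDl mul1r; set x := _ / _ in hgk.
  apply: (@le_trans _ _ (`|class_weight w h k - x| +
      `|x - b (p k) / fiber_size R p (p k) * alpha_tot G|)).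
    by apply: le_trans (ler_normD _ _); rewrite addrA subrK.
  apply: lerD => //; rewrite /x mulrAC -mulrBl normrM normfV.
  rewrite (ger0_norm (ltW (p0 _))) ler_pdivrMr //.
  apply: (le_trans (bg (p k))); rewrite ler_peMr //; exact: fiber_size_ge1.
have := moved_weight_trans (coarsen p f') (coarsen p h) f w0.
have := moved_weight_trans (coarsen p h) g f w0.
have := moved_weight_coarsen p f' h w0.
rewrite !card_ord in cg.
rewrite !mulrDl !mulrDr in gf fh *; nra.
Qed.

(** Mix a with the uniform distribution to gain a margin proportional to s,
    interpolate between h1 / q and the mixture so that the sum becomes h2, and
    let rounding turn the result into integer fiber sizes.  Shifting the
    mixture by the rounding error makes b at least m_i h2 / r exactly; this is
    needed because for h2 = 1 the distribution on r colours must be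
    uniform. *)
Lemma exists_fibers q r (h1 h2 s : R) (a : 'I_q -> R) :
  (0 < q)%N -> (0 < r)%N -> 0 <= h1 -> h1 < h2 -> h2 <= 1 ->
  0 < s -> s <= 1 -> r%:R^-1 <= s * (h2 - h1) / (2 * q%:R) ->
  dist_ge (h1 / q%:R) a ->
  exists (p : {ffun 'I_r -> 'I_q}) (b : 'I_q -> R),
  [/\ prob_dist b,
    forall i, h1 / q%:R + s * (h2 - h1) / (2 * q%:R) <= fiber_size R p i * (h2 / r%:R),
    forall i, fiber_size R p i * (h2 / r%:R) <= b i &
    forall i, `|a i - b i| <= s + r%:R^-1].
Proof.
move=> q0 r0 h10 h12 h21 s0 s1 rs [[a0 a1] ca].
have q1 : 0 < q%:R :> R by rewrite ltr0n.
have r1 : 0 < r%:R :> R by rewrite ltr0n.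
have h1lt1 : h1 < 1 := lt_le_trans h12 h21.
have h20 : 0 < h2 := le_lt_trans h10 h12.
pose theta := (h2 - h1) / (1 - h1).
have th0 : 0 <= theta by rewrite /theta divr_ge0 // subr_ge0 ltW.
have th1 : theta <= 1 by rewrite /theta ler_pdivrMr; lra.
have thE : theta * (1 - h1) = h2 - h1 by rewrite /theta divfK // subr_eq0 gt_eqF.
pose mix i := (1 - s) * a i + s / q%:R.
pose x i := h1 / q%:R + theta * (mix i - h1 / q%:R).
have sum_const (y : R) : \sum_(i < q) y / q%:R = y.
  by rewrite sumr_const card_ord -[_ *+ _]mulr_natr divfK // gt_eqF.
have mix1 : \sum_i mix i = 1 by rewrite big_split /= -mulr_sumr a1 sum_const; lra.
have sum_x : \sum_i x i = h2.
  by rewrite big_split /= sum_const -mulr_sumr sumrB mix1 sum_const thE; lra.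
have mix_ge i : s * (1 - h1) / q%:R <= mix i - h1 / q%:R.
  have := ler_wpM2l (_ : 0 <= 1 - s) (ca i).
  rewrite subr_ge0 => /(_ s1); rewrite /mix; lra.
have x_mix i : x i <= mix i.
  have : 0 <= mix i - h1 / q%:R.
    apply: le_trans (mix_ge i); rewrite divr_ge0 // mulr_ge0; lra.
  rewrite /x; nra.
have x_ge i : h1 / q%:R + s * (h2 - h1) / q%:R <= x i.
  rewrite /x lerD2l; apply: le_trans (ler_wpM2l th0 (mix_ge i)).
  by rewrite -thE; lra.
(* Fiber sizes are class weights for unit node weights, so each one is
   rounded with error at most 1. *)
have [||||p [px _]] := @rounding R 'I_r 'I_q (fun=> 1) 1
    (fun i => x i * (r%:R / h2)) [ffun=> Ordinal q0].
- by [].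
- by move=> _; rewrite ler01 lexx.
- move=> i; rewrite mulr_ge0 ?divr_ge0 // ?ltW //.
  apply: lt_le_trans (x_ge i); rewrite ltr_wpDl ?divr_ge0 // ?ltW //.
  by rewrite divr_gt0 // mulr_gt0 // subr_gt0.
- by rewrite -mulr_suml sum_x sumr_const card_ord mulrC divfK ?gt_eqF.
pose y i := fiber_size R p i * (h2 / r%:R).
have hr0 : 0 <= h2 / r%:R by rewrite divr_ge0 // ltW.
have yx i : `|y i - x i| <= r%:R^-1.
  have -> : y i - x i = (fiber_size R p i - x i * (r%:R / h2)) * (h2 / r%:R).
    by rewrite /y; field; rewrite !gt_eqF.
  rewrite normrM (ger0_norm hr0); apply: le_trans (ler_wpM2r hr0 (px i)) _.
  by rewrite mul1r ler_pdivrMr // mulVf ?gt_eqF.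
have y_ge i : h1 / q%:R + s * (h2 - h1) / (2 * q%:R) <= y i.
  have := yx i; rewrite ler_norml => /andP[+ _].
  have := x_ge i.
  have -> : s * (h2 - h1) / q%:R = s * (h2 - h1) / (2 * q%:R) + s * (h2 - h1) / (2 * q%:R).
    by field; rewrite gt_eqF.
  lra.
have y0 i : 0 <= y i by rewrite mulr_ge0 // sumr_ge0.
exists p, (fun i => mix i + (y i - x i)); split=> // [|i|i].
- split=> [i|]; first by have := y0 i; have := x_mix i; lra.
  rewrite big_split sumrB mix1 sum_x /= -mulr_suml class_weight_sum.
  by rewrite sumr_const card_ord mulrC divfK ?gt_eqF // subrr addr0.
- by have := x_mix i; rewrite -/(y i); lra.
have a_le1 : a i <= 1 by rewrite -a1 (bigD1 i) //= lerDl sumr_ge0.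
have q_le1 : q%:R^-1 <= 1 :> R by rewrite invf_le1 // ler1n.
rewrite opprD addrA; apply: (le_trans (ler_normB _ _)); apply: lerD => //.
have -> : a i - mix i = s * (a i - q%:R^-1) by rewrite /mix; lra.
rewrite normrM (ger0_norm (ltW s0)) ler_piMr ?(ltW s0) //.
have : 0 <= q%:R^-1 :> R by rewrite invr_ge0.
have := a0 i; rewrite ler_norml; lra.
Qed.
End Comparison.

(** * Convergence *)

Section Convergence.
Variable R : realType.

(** The error of the second inequality has three parts, each at most e / 3: the
    choice of a nearly optimal colouring, the distance from a to b, which is
    controlled by s and 1 / r, and the rounding, which is controlled by
    alpha_max once r is fixed. *)
Lemma gse_sandwich (G : nat -> weighted_graph R) (h1 h2 e : R) q (J : 'M[R]_q) :
  unif_bounded_edge_weights G ->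
  (fun n => alpha_max (G n) / alpha_tot (G n)) @ \oo --> (0 : R) ->
  (0 < q)%N -> 0 <= h1 -> h1 < h2 -> h2 <= 1 -> 0 < e ->
  exists2 r, (0 < r)%N & exists P : {ffun 'I_r -> 'I_q} -> Prop,
  \forall n \near \oo,
    (forall p, P p -> lower_threshold_gse (h1 / q%:R) (G n) J <=
       lower_threshold_gse (h2 / r%:R) (G n) (pullback_mx p J)) /\
    (exists2 p, P p & lower_threshold_gse (h2 / r%:R) (G n) (pullback_mx p J) <=
       lower_threshold_gse (h1 / q%:R) (G n) J + e).
Proof.
move=> [B0 leB0] small q0 h10 h12 h21 e0.
have [B B_ge0 leB] : exists2 B : R, 0 <= B &
    forall n (u v : vertex (G n)), `|edge_weight u v| <= B.
  by exists `|B0| => // n u v; apply: le_trans (leB0 n u v) (ler_norm _).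
pose K : R := \sum_i \sum_j `|J i j|.
have K_ge0 : 0 <= K by apply: sumr_ge0 => i _; exact: sumr_ge0.
have leK i j : `|J i j| <= K.
  rewrite /K (bigD1 i) //= (bigD1 j) //= -addrA lerDl addr_ge0 //.
    exact: sumr_ge0.
  by apply: sumr_ge0 => k _; exact: sumr_ge0.
pose L := 4 * B * K.
have L0 : 0 <= L by rewrite /L !mulr_ge0.
have q1 : 0 < q%:R :> R by rewrite ltr0n.
have h20 : 0 < h2 := le_lt_trans h10 h12.
pose s := Num.min 1 (e / (6 * (L * q%:R ^+ 2 + 1))).
have D0 : 0 < 6 * (L * q%:R ^+ 2 + 1).
  by rewrite mulr_gt0 // ltr_wpDl // mulr_ge0 // sqr_ge0.
have s0 : 0 < s by rewrite lt_min ltr01 divr_gt0.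
have s1 : s <= 1 by rewrite ge_min lexx.
have Ls : 6 * (L * q%:R ^+ 2 * s) <= e.
  have : s * (6 * (L * q%:R ^+ 2 + 1)) <= e.
    by rewrite -ler_pdivlMr // ge_min lexx orbT.
  lra.
pose d := s * (h2 - h1) / (2 * q%:R).
have d0 : 0 < d by rewrite divr_gt0 ?mulr_gt0 // subr_gt0.
have ds : d <= s.
  rewrite ler_pdivrMr ?mulr_gt0 // ler_pM2l //.
  have : 1 <= q%:R :> R by rewrite ler1n.
  lra.
have [k] := ltr_add_invr d0; rewrite add0r => /ltW rd.
set r := k.+1 in rd; have r0 : (0 < r)%N by [].
have r1 : 0 < r%:R :> R by rewrite ltr0n.
exists r => //; exists (fun p => forall i, h1 / q%:R + d <= fiber_size R p i * (h2 / r%:R)).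
pose C : R := q%:R ^+ 2 + q%:R * r%:R + r%:R ^+ 2 * (q%:R + 1).
have C0 : 0 <= C by rewrite !addr_ge0 // ?mulr_ge0 ?sqr_ge0 // addr_ge0.
pose t := Num.min (d / r%:R) (e / (3 * (L * C + 1))).
have D'0 : 0 < 3 * (L * C + 1) by rewrite mulr_gt0 // ltr_wpDl // mulr_ge0.
have t0 : 0 < t by rewrite lt_min; apply/andP; split; exact: divr_gt0.
have rt : r%:R * t <= d by rewrite mulrC -ler_pdivlMr // ge_min lexx.
have LCt : 3 * (L * C * t) <= e.
  have : t * (3 * (L * C + 1)) <= e by rewrite -ler_pdivlMr // ge_min lexx orbT.
  lra.
have h2r : h2 / r%:R <= r%:R^-1 by rewrite ler_pdivrMr // mulVf ?gt_eqF.
have h1q : h1 / q%:R <= q%:R^-1.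
  by rewrite ler_pdivrMr // mulVf ?gt_eqF // (le_trans (ltW h12)).
have /cvgrPdist_le/(_ t t0) := small; apply: filterS => n.
have A0 := alpha_tot_gt0 (G n).
rewrite sub0r normrN ger0_norm; last first.
  by rewrite divr_ge0 ?alpha_max_ge0 // ltW.
move=> eta; split=> [p Pp|].
  apply: (gse_le_pullback (d := d)) => //; first by rewrite divr_ge0 // ltW.
  rewrite -ler_pdivrMr // -mulrA; apply: le_trans rt.
  exact: ler_wpM2l.
have e3 : 0 < e / 3 by rewrite divr_gt0.
have [a [f [ca af lt_f]]] := lower_threshold_gse_adherent (G n) J q0 h1q e3.
have [p [b [pb Pp bp ab]]] := exists_fibers q0 r0 h10 h12 h21 s0 s1 rd ca.
have p0 i : 0 < fiber_size R p i.
  have : 0 < fiber_size R p i * (h2 / r%:R).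
    by apply: lt_le_trans (Pp i); rewrite ltr_wpDl // divr_ge0 // ltW.
  by rewrite pmulr_lgt0 // divr_gt0.
have [f' bf' moved] := refine_coloring r0 pb p0 af.
exists p => //.
have le_f' : lower_threshold_gse (h2 / r%:R) (G n) (pullback_mx p J) <=
    energy (coarsen p f') J.
  rewrite -energy_coarsen; apply: lower_threshold_gse_le bf'.
  split=> [|k']; last by rewrite ler_pdivlMr // mulrC.
  split=> [k'|]; first by rewrite divr_ge0 ?pb.1 // ltW.
  by rewrite sum_constant_on_fibers // pb.2.
have := energy_lipschitz (coarsen p f') f (leB n) leK.
rewrite ler_norml => /andP[_].
have : L * (moved_weight (@node_weight R (G n)) (coarsen p f') f / alpha_tot (G n))
    <= L * (q%:R ^+ 2 * (2 * s) + C * t).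
  rewrite ler_wpM2l // ler_pdivrMr //; apply: (le_trans moved).
  rewrite [leRHS]mulrDl; apply: lerD.
    rewrite ler_wpM2r ?(ltW A0) // expr2 -mulrA ler_wpM2l // mulr_natl.
    rewrite -[X in _ *+ X]card_ord -sumr_const; apply: ler_sum => i _.
    have := ab i; lra.
  by rewrite -[leRHS]mulrA; apply: ler_wpM2l; rewrite // -ler_pdivrMr.
rewrite -/L; lra.
Qed.

(** The one-sided inequality is enough because m and n can be exchanged. *)
Lemma cauchy_seq_cvg (u : nat -> R) :
  (forall e : R, 0 < e -> exists N, forall m n, (N <= m)%N -> (N <= n)%N ->
     u m <= u n + e) -> cvg (u @ \oo).
Proof.
move=> uC; apply/cauchy_cvgP/cauchy_exP => e e0.
have [|N uN] := uC (e / 2); first by rewrite divr_gt0.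
exists (u N); exists N => // n /= Nn.
rewrite /ball /= ltr_norml.
have := uN n N Nn (leqnn N); have := uN N n (leqnn N) Nn; lra.
Qed.
End Convergence.

Theorem corollary3p4 (R : realType) (G : nat -> weighted_graph R)
  (c1 c2 : nat -> R) (h1 h2 : R)
  (G_bounded : unif_bounded_edge_weights G)
  (G_no_dominant : (fun n => alpha_max (G n) / alpha_tot (G n)) @ \oo --> (0 : R))
  (c1_threshold : lower_threshold_function c1)
  (c2_threshold : lower_threshold_function c2)
  (h1_range : 0 <= h1 <= 1) (h2_range : 0 <= h2 <= 1)
  (h1_lt_h2 : h1 < h2)
  (c1E : forall q : nat, (0 < q)%N -> c1 q * q%:R = h1)
  (c2E : forall q : nat, (0 < q)%N -> c2 q * q%:R = h2)
  (c2_cvg : forall (q : nat) (J : 'M[R]_q), (0 < q)%N -> sym_mx J ->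
     cvg ((fun n => lower_threshold_gse (c2 q) (G n) J) @ \oo)) :
  forall (q : nat) (J : 'M[R]_q), (0 < q)%N -> sym_mx J ->
    cvg ((fun n => lower_threshold_gse (c1 q) (G n) J) @ \oo).
Proof.
move=> q J q0 symJ; apply: cauchy_seq_cvg => e e0.
have e3 : 0 < e / 3 by rewrite divr_gt0.
have {h1_range}[h10 _] := andP h1_range; have {h2_range}[_ h21] := andP h2_range.
have [r r0 [P]] := gse_sandwich J G_bounded G_no_dominant q0 h10 h1_lt_h2 h21 e3.
have -> : h1 / q%:R = c1 q by rewrite -(c1E q q0) mulfK // pnatr_eq0 -lt0n.
have -> : h2 / r%:R = c2 r by rewrite -(c2E r r0) mulfK // pnatr_eq0 -lt0n.
pose u (p : {ffun 'I_r -> 'I_q}) n := lower_threshold_gse (c2 r) (G n) (pullback_mx p J).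
have u_cvg : \forall n \near \oo, forall p, `|lim (u p @ \oo) - u p n| <= e / 3.
  apply: filter_forall => p.
  by have /cvgrPdist_le/(_ _ e3) := c2_cvg r _ r0 (pullback_mx_sym p symJ).
move=> sandwich; have [N _ HN] := filterI sandwich u_cvg.
exists N => m n Nm Nn.
have [[+ _] /= um] := HN m Nm; have [[_ [p Pp le_p]] /= un] := HN n Nn.
(* The map p that is nearly optimal for n also bounds the energy for m. *)
move=> /(_ p Pp).
have := um p; have := un p; rewrite !ler_norml -/(u p n) -/(u p m).
rewrite -/(u p n) in le_p.
move=> /andP[n1 n2] /andP[m1 m2]; lra.
Qed.
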